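(* There is an algorithm that solves the single-capacity unbounded knapsack problem in $O(nu\log^2 u)$ time, where $n$ is the number of items and $u=\max_i w_i$.
   Context: Single-capacity unbounded knapsack: given $n$ items, item $i$ having a positive integer weight $w_i$ and a positive profit $p_i$, and a positive integer capacity $t$, compute the maximum of $\sum_{i=1}^n m_i p_i$ over all $m_1,\dots,m_n\in\mathbb{N}=\{0,1,2,\dots\}$ with $\sum_{i=1}^n m_i w_i\le t$. *)

(* Defs.v *)
From mathcomp Require Import all_boot all_order all_algebra.

Set Implicit Arguments.
Unset Strict Implicit.
Unset Printing Implicit Defensive.

Import Order.TTheory GRing.Theory Num.Theory.
Local Open Scope ring_scope.

Definition feasible (n : nat) (w : 'I_n -> nat) (t : nat) (m : 'I_n -> nat) :=
  (\sum_i m i * w i <= t)%N.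

Definition profit (R : realFieldType) (n : nat) (p : 'I_n -> R)
    (m : 'I_n -> nat) : R :=
  \sum_i (m i)%:R * p i.

Definition knapsack_max (R : realFieldType) (n : nat) (w : 'I_n -> nat)
    (p : 'I_n -> R) (t : nat) (v : R) : Prop :=
  (exists m, feasible w t m /\ profit p m = v) /\
  (forall m, feasible w t m -> profit p m <= v).

(* Programs run on a word RAM with [b]-bit words, extended with real arithmetic as in the real
  RAM: weights, capacities, counters and addresses are words, profits are
  exact elements of an ordered field [R].  There is no operation from [R] to
  words (no rounding), so [R] influences words only through the outcome of
  comparisons.  A program mentions neither [R] nor [b], and it uses finitely
  many registers; memory is reached by indirect addressing only. *)

Definition reg := nat.

Inductive wop := WAdd | WSub | WMul | WDiv | WMod.
Inductive rop := RAdd | RSub | RMul | RDiv.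

Inductive instr :=
  | WConst (d : reg) (k : nat)
  | WMove (d x : reg)
  | WOp (o : wop) (d x y : reg)
  | WLoad (d a : reg)
  | WStore (a x : reg)
  | RMove (d x : reg)
  | ROp (o : rop) (d x y : reg)
  | RLoad (d a : reg)
  | RStore (a x : reg)
  | ROfWord (d x : reg).

Inductive test :=
  | WLt (x y : reg)
  | WEq (x y : reg)
  | RLt (x y : reg).

Inductive cmd :=
  | Instr (i : instr)
  | Seq (c1 c2 : cmd)
  | If (q : test) (c1 c2 : cmd)
  | While (q : test) (c : cmd).

Record state (R : Type) := State {
  wreg : reg -> nat;
  wmem : nat -> nat;
  rreg : reg -> R;
  rmem : nat -> R
}.

Definition upd (T : Type) (f : nat -> T) (a : nat) (v : T) : nat -> T :=
  fun x => if x == a then v else f x.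

(* Word arithmetic is unsigned and modulo [2 ^ b]. *)
Definition wop_eval (b : nat) (o : wop) (x y : nat) : nat :=
  match o with
  | WAdd => (x + y) %% 2 ^ b
  | WSub => (x + (2 ^ b - y)) %% 2 ^ b
  | WMul => (x * y) %% 2 ^ b
  | WDiv => x %/ y
  | WMod => x %% y
  end%N.

Definition rop_eval (R : realFieldType) (o : rop) (x y : R) : R :=
  match o with
  | RAdd => x + y
  | RSub => x - y
  | RMul => x * y
  | RDiv => x / y
  end.

Definition instr_eval (R : realFieldType) (b : nat) (i : instr) (s : state R) :
    state R :=
  let: State W M X Y := s in
  match i with
  | WConst d k => State (upd W d (k %% 2 ^ b)%N) M X Y
  | WMove d x => State (upd W d (W x)) M X Y
  | WOp o d x y => State (upd W d (wop_eval b o (W x) (W y))) M X Y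
  | WLoad d a => State (upd W d (M (W a))) M X Y
  | WStore a x => State W (upd M (W a) (W x)) X Y
  | RMove d x => State W M (upd X d (X x)) Y
  | ROp o d x y => State W M (upd X d (rop_eval o (X x) (X y))) Y
  | RLoad d a => State W M (upd X d (Y (W a))) Y
  | RStore a x => State W M X (upd Y (W a) (X x))
  | ROfWord d x => State W M (upd X d (W x)%:R) Y
  end.

Definition test_eval (R : realFieldType) (q : test) (s : state R) : bool :=
  match q with
  | WLt x y => (wreg s x < wreg s y)%N
  | WEq x y => wreg s x == wreg s y
  | RLt x y => rreg s x < rreg s y
  end.

(* [exec b c s k s']: started in [s], the program [c] halts in [s'] after [k]
   steps; every instruction and every evaluation of a test is one step. *)
Inductive exec (R : realFieldType) (b : nat) :
    cmd -> state R -> nat -> state R -> Prop :=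
  | ExecInstr i s : exec b (Instr i) s 1%N (instr_eval b i s)
  | ExecSeq c1 c2 s s1 s2 k1 k2 :
      exec b c1 s k1 s1 -> exec b c2 s1 k2 s2 ->
      exec b (Seq c1 c2) s (k1 + k2)%N s2
  | ExecIfT q c1 c2 s s1 k :
      test_eval q s -> exec b c1 s k s1 -> exec b (If q c1 c2) s k.+1 s1
  | ExecIfF q c1 c2 s s1 k :
      ~~ test_eval q s -> exec b c2 s k s1 -> exec b (If q c1 c2) s k.+1 s1
  | ExecWhileT q c s s1 s2 k1 k2 :
      test_eval q s -> exec b c s k1 s1 -> exec b (While q c) s1 k2 s2 ->
      exec b (While q c) s (k1 + k2).+1%N s2
  | ExecWhileF q c s :
      ~~ test_eval q s -> exec b (While q c) s 1%N s.

Definition array (T : Type) (n : nat) (z : T) (f : 'I_n -> T) : nat -> T :=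
  fun a => if insub a is Some i then f i else z.

(* Input: [n] and [t] in word registers 0 and 1, the weights and the profits
   in cells 0, ..., n-1 of the word memory and of the real memory. *)
Definition input (R : realFieldType) (n : nat) (w : 'I_n -> nat)
    (p : 'I_n -> R) (t : nat) : state R :=
  State (upd (upd (fun=> 0) 0 n) 1 t)%N (array 0%N w) (fun=> 0) (array 0 p).

Definition output (R : realFieldType) (s : state R) : R := rreg s 0%N.

Definition max_weight (n : nat) (w : 'I_n -> nat) : nat := (\max_i w i)%N.

(* The binary logarithm, rounded down, in time bounds; it is replaced by 1 at
   1, where the bound n * u * log^2 u would vanish. *)
Definition log (u : nat) : nat := maxn 1 (trunc_log 2 u).

(* The number of binary digits of N > 0. *)
Definition bits (N : nat) : nat := (trunc_log 2 N).+1.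

(* Main.v *)
(** Write u for the maximal weight, L for its number of binary digits.  If a
    solution uses more than 2L distinct items, two subsets of its support have
    the same weight, and exchanging them kills an item without losing profit;
    so some optimal solution has support at most 2L.  Its vector of parities
    then weighs at most [slack] = 2Lu, and m = 2m' + r reduces the optima for
    capacities just below T to those for capacities just below T / 2, at the
    cost of one 0/1 dynamic program over a window of O(Lu) capacities, that is
    O(nuL) steps.  There are only O(L) levels once t = O(Lu^2).  For larger t,
    let a be the weight of an item of best profit-to-weight ratio: every other
    item may be assumed to occur fewer than a times, hence the other items of a
    solution of small support weigh at most [slack] * u, and copies of the best
    item fill the rest. *)

Require Import Defs.
From mathcomp Require Import all_boot all_order all_algebra.
From mathcomp Require Import zify.

Set Implicit Arguments.
Unset Strict Implicit.
Unset Printing Implicit Defensive.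

Import Order.TTheory GRing.Theory Num.Theory.
Local Open Scope ring_scope.

(** * Binary digits *)

Lemma ltn_exp_bits k : (k < 2 ^ bits k)%N.
Proof. exact: trunc_log_ltn. Qed.

Lemma ltn_bits k z : (0 < z)%N -> (k < bits z)%N = (2 ^ k <= z)%N.
Proof.
move=> z_gt0; rewrite ltnS; apply/idP/idP => [le_k|]; last exact: trunc_log_max.
by apply: leq_trans (trunc_logP (isT : 1 < 2)%N z_gt0); rewrite leq_exp2l.
Qed.

Lemma leq_bits k z : (0 < z)%N -> (bits z <= k)%N = (z < 2 ^ k)%N.
Proof. by move=> z_gt0; rewrite leqNgt ltn_bits // -ltnNge. Qed.

Lemma leq_exp_bits z : (0 < z)%N -> (2 ^ bits z <= 2 * z)%N.
Proof. by move=> z_gt0; rewrite expnS leq_mul2l trunc_logP. Qed.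

Lemma leq_bits_log z : (bits z <= 2 * log z)%N.
Proof. by rewrite /bits /log; lia. Qed.

Lemma ltn_mul_exp2 u s : (2 * bits u < s)%N -> ((s * u).+1 < 2 ^ s)%N.
Proof.
move=> lt_s; have lt_u := ltn_exp_bits u.
have lt_exp : (s < 2 ^ (s - bits u))%N.
  have := ltn_expl (s - bits u).-1 (isT : (1 < 2)%N).
  have -> : (s - bits u = (s - bits u).-1.+1)%N by lia.
  by rewrite expnS /=; lia.
apply: (@leq_trans (2 ^ (s - bits u) * 2 ^ bits u)); first by nia.
by rewrite -expnD leq_pexp2l //; lia.
Qed.

(** * Linear combinations with natural coefficients *)

Section Lincomb.

Variables (I : finType) (V : nmodType).
Implicit Types (f : I -> V) (m : I -> nat).

Definition lincomb f m : V := \sum_i f i *+ m i.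

Lemma eq_lincomb f m1 m2 : m1 =1 m2 -> lincomb f m1 = lincomb f m2.
Proof. by move=> eq_m; apply: eq_bigr => i _; rewrite eq_m. Qed.

Lemma lincomb0 f : lincomb f (fun=> 0%N) = 0.
Proof. exact: big1. Qed.

Lemma lincombD f m1 m2 :
  lincomb f (fun i => m1 i + m2 i)%N = lincomb f m1 + lincomb f m2.
Proof. by rewrite -big_split; apply: eq_bigr => i _; rewrite mulrnDr. Qed.

Lemma lincombD1 f i0 m :
  lincomb f m = f i0 *+ m i0 + \sum_(i | i != i0) f i *+ m i.
Proof. exact: bigD1. Qed.

Lemma lincomb_indic f (A : pred I) k :
  lincomb f (fun i => k * A i)%N = (\sum_(i | A i) f i) *+ k.
Proof.
rewrite -sumrMnl [RHS]big_mkcond; apply: eq_bigr => i _.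
by case: (A i); rewrite ?muln1 // muln0.
Qed.

Lemma lincomb_add_copies f i0 k m :
  lincomb f (fun i => m i + k * (i == i0))%N = lincomb f m + f i0 *+ k.
Proof. by rewrite lincombD (lincomb_indic f (pred1 i0)) big_pred1_eq. Qed.

Definition support m : {set I} := [set i | (0 < m i)%N].

Definition odd_support m : {set I} := [set i | odd (m i)].

Lemma odd_support_sub m : odd_support m \subset support m.
Proof. by apply/subsetP => i; rewrite !inE; exact: odd_gt0. Qed.

Lemma lincomb_halves f m :
  lincomb f m =
  lincomb f (fun i => m i %/ 2)%N *+ 2 + \sum_(i in odd_support m) f i.
Proof.
rewrite mulr2n -lincombD -[X in _ + X]mulr1n -lincomb_indic -lincombD.
by apply: eq_lincomb => i; rewrite mul1n inE; lia.
Qed.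

End Lincomb.

(** * Solutions of small support *)

Lemma equal_sum_subsets (I : finType) (w : I -> nat) (S : {set I}) :
  ((\sum_(i in S) w i).+1 < 2 ^ #|S|)%N ->
  exists A B : {set I}, [/\ A \subset S, B \subset S, A != B &
    (\sum_(i in A) w i = \sum_(i in B) w i)%N].
Proof.
set W := (\sum_(i in S) w i)%N => W_small.
pose sum_in (A : {set I}) : 'I_W.+1 := inord (\sum_(i in A) w i).
have sum_inE (A : {set I}) :
    A \subset S -> sum_in A = (\sum_(i in A) w i)%N :> nat.
  move=> sAS; rewrite inordK // ltnS /W [leqRHS](big_setID A) /=.
  by rewrite (setIidPr sAS) leq_addr.
have /dinjectivePn[A sAS [B]] : ~~ dinjectiveb sum_in (powerset S).
  apply/negP => /dinjectiveP inj_sum; have := max_card (sum_in @: powerset S).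
  by rewrite card_in_imset // card_powerset card_ord leqNgt W_small.
move: sAS; rewrite !inE => sAS /andP[neBA sBS] eqAB.
by exists A, B; rewrite eq_sym -!sum_inE ?eqAB.
Qed.

Lemma disjoint_equal_sum_subsets (I : finType) (w : I -> nat) (S : {set I}) :
  (forall i, 0 < w i)%N -> ((\sum_(i in S) w i).+1 < 2 ^ #|S|)%N ->
  exists A B : {set I}, [/\ A \subset S /\ B \subset S, [disjoint A & B],
    A != set0, B != set0 & (\sum_(i in A) w i = \sum_(i in B) w i)%N].
Proof.
move=> w_gt0 /equal_sum_subsets[A [B [sAS sBS neAB eq_sum]]].
have eq_sumD : (\sum_(i in A :\: B) w i = \sum_(i in B :\: A) w i)%N.
  move: eq_sum; rewrite (big_setID B) [RHS](big_setID A) /= setIC.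
  by move/addnI.
have eq_set0 (C D : {set I}) :
    (\sum_(i in C) w i = \sum_(i in D) w i)%N -> D = set0 -> C = set0.
  move=> eqCD D0; apply/setP => i; rewrite inE; apply/negP => iC.
  by move: eqCD; rewrite D0 big_set0 (bigD1 i) //=; have := w_gt0 i; lia.
have neq0 : A :\: B != set0.
  apply: contra neAB => /eqP AB0.
  by rewrite eqEsubset -!setD_eq0 AB0 (eq_set0 _ _ (esym eq_sumD) AB0) eqxx.
exists (A :\: B), (B :\: A); split=> //.
- by rewrite !(subset_trans (subsetDl _ _)).
- rewrite -setI_eq0; apply/eqP/setP => i; rewrite !inE.
  by case: (i \in A); rewrite ?andbF.
- by apply: contra neq0 => /eqP/(eq_set0 _ _ eq_sumD)->.
Qed.

Section SmallSupport.

Variables (I : finType) (R : realDomainType) (w : I -> nat) (p : I -> R).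
Hypothesis w_gt0 : forall i, (0 < w i)%N.

Definition improvement (m m' : I -> nat) : Prop :=
  lincomb w m' = lincomb w m /\ lincomb p m <= lincomb p m'.

Lemma improvement_trans m2 m1 m3 :
  improvement m1 m2 -> improvement m2 m3 -> improvement m1 m3.
Proof.
by move=> [w12 p12] [w23 p23]; split; [rewrite w23 | apply: le_trans p23].
Qed.

(* Items of A gain, and items of B lose, as many copies as the rarest item of B
   has. *)
Lemma exchange_subsets m (A B : {set I}) :
  A \subset support m -> B \subset support m -> [disjoint A & B] ->
  B != set0 -> (\sum_(i in A) w i = \sum_(i in B) w i)%N ->
  \sum_(i in B) p i <= \sum_(i in A) p i ->
  exists2 m', improvement m m' & support m' \proper support m.
Proof.
move=> sAm sBm disjAB /set0Pn[i0 i0B] eq_w le_p.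
have [j jB min_j] := arg_minnP (P := fun i => i \in B) m i0B.
pose m' i := (m i + m j * (i \in A) - m j * (i \in B))%N.
have m'E i : (m' i + m j * (i \in B) = m i + m j * (i \in A))%N.
  by rewrite subnK //; case: (boolP (i \in B)) => [/min_j|_]; lia.
have lincomb_m' (V : nmodType) (f : I -> V) :
    lincomb f m' + (\sum_(i in B) f i) *+ m j =
    lincomb f m + (\sum_(i in A) f i) *+ m j.
  by rewrite -!lincomb_indic -!lincombD; exact: eq_lincomb.
exists m'; first split.
- by have := lincomb_m' _ w; rewrite eq_w => /addIn.
- rewrite -(lerD2r ((\sum_(i in B) p i) *+ m j)) lincomb_m' lerD2l.
  by rewrite lerMn2r le_p orbT.
- apply/properP; split.
    apply/subsetP => i; rewrite !inE; case: (boolP (i \in A)) => [|iA].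
      by move/(subsetP sAm); rewrite inE.
    by rewrite /m' (negbTE iA); lia.
  exists j; first exact: (subsetP sBm).
  by rewrite inE /m' jB (disjointFl disjAB jB) muln0 addn0 muln1 subnn.
Qed.

Variable u : nat.
Hypothesis w_le : forall i, (w i <= u)%N.

Lemma sum_weight_le (A : {set I}) : (\sum_(i in A) w i <= #|A| * u)%N.
Proof. by rewrite -sum_nat_const; exact: leq_sum. Qed.

Lemma improve_large_support m : (2 * bits u < #|support m|)%N ->
  exists2 m', improvement m m' & support m' \proper support m.
Proof.
move=> large_m.
have [|A [B [[sAm sBm] disjAB A0 B0 eq_w]]] :=
    disjoint_equal_sum_subsets (S := support m) w_gt0.
  by apply: leq_ltn_trans (ltn_mul_exp2 large_m); rewrite ltnS sum_weight_le.
case: (leP (\sum_(i in B) p i) (\sum_(i in A) p i)) => [|/ltW] le_p.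
  exact: (@exchange_subsets _ A B).
by apply: (@exchange_subsets _ B A); rewrite // disjoint_sym.
Qed.

Lemma small_support m :
  exists2 m', improvement m m' & (#|support m'| <= 2 * bits u)%N.
Proof.
have [k] := ubnP #|support m|; elim: k m => // k IH m lt_k.
case: (leqP #|support m| (2 * bits u)) => [|large_m]; first by exists m.
have [m1 imp_m1 /proper_card lt_m1] := improve_large_support large_m.
have [|m2 imp_m2 small_m2] := IH m1; first by lia.
by exists m2 => //; exact: improvement_trans imp_m1 imp_m2.
Qed.

Definition slack : nat := (2 * bits u * u)%N.

Definition odd_weight_wlog (D : nat) : Prop := forall m,
  exists2 m', improvement m m' & (\sum_(i in odd_support m') w i <= D)%N.

Lemma odd_weight_wlog_slack : odd_weight_wlog slack.
Proof.
move=> m; have [m' imp_m' small_m'] := small_support m; exists m' => //.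
apply: leq_trans (sum_weight_le _) _; rewrite leq_mul2r; apply/orP; right.
exact: leq_trans (subset_leq_card (odd_support_sub m')) small_m'.
Qed.

End SmallSupport.

(** * Optimal profits *)

Section Optima.

Variables (I : finType) (R : realDomainType) (w : I -> nat) (p : I -> R).

Definition achieves (t : nat) (v : R) :=
  exists2 m, (lincomb w m <= t)%N & lincomb p m = v.

Definition dominates (t : nat) (v : R) :=
  forall m, (lincomb w m <= t)%N -> lincomb p m <= v.

Definition optimal (t : nat) (v : R) := achieves t v /\ dominates t v.

Lemma dominates_wlog (P : (I -> nat) -> Prop) t v :
  (forall m, exists2 m', improvement w p m m' & P m') ->
  (forall m, P m -> (lincomb w m <= t)%N -> lincomb p m <= v) ->
  dominates t v.
Proof.
move=> wlogP domP m le_t; have [m' [w_m' /le_trans le_p] Pm'] := wlogP m.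
by apply/le_p/domP; rewrite ?w_m'.
Qed.

Lemma achieves_add_copies i k t v :
  achieves t v -> achieves (t + k * w i) (v + p i *+ k).
Proof.
move=> [m le_t <-]; exists (fun j => m j + k * (j == i))%N.
  by rewrite lincomb_add_copies; lia.
exact: lincomb_add_copies.
Qed.

Lemma achieves_double t v : achieves t v -> achieves (2 * t) (v *+ 2).
Proof.
move=> [m le_t <-]; exists (fun i => m i + m i)%N; rewrite lincombD ?mulr2n //.
by move: le_t; lia.
Qed.

Lemma achieves_le t1 t2 v : (t1 <= t2)%N -> achieves t1 v -> achieves t2 v.
Proof. by move=> le_t [m le_m <-]; exists m => //; exact: leq_trans le_t. Qed.

Hypothesis w_gt0 : forall i, (0 < w i)%N.

Lemma optimal0 : optimal 0 0.
Proof.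
split; first by exists (fun=> 0%N); rewrite lincomb0.
move=> m; rewrite leqn0 sum_nat_eq0 => /forallP m0.
rewrite (eq_lincomb _ (m2 := fun=> 0%N)) ?lincomb0 // => i.
by have := m0 i; have := w_gt0 i; case: (m i) => // k; nia.
Qed.

Definition ratio_le (i j : I) : bool := p i *+ w j <= p j *+ w i.

Definition best_ratio (i0 : I) : Prop := forall i, ratio_le i i0.

Lemma ratio_le_trans j i k : ratio_le i j -> ratio_le j k -> ratio_le i k.
Proof.
rewrite /ratio_le => /(ler_wMn2r (w k)) le_ij /(ler_wMn2r (w i)) le_jk.
rewrite -(ler_pMn2r (w_gt0 j)) mulrnAC (le_trans le_ij) //.
by rewrite mulrnAC (le_trans le_jk) // mulrnAC.
Qed.

Variable i0 : I.
Hypothesis best_i0 : best_ratio i0.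

(* [w i0] copies of an item weigh as much as [w i] copies of [i0]. *)
Definition concentrate (m : I -> nat) (i : I) : nat :=
  if i == i0 then (m i0 + \sum_(j | j != i0) w j * (m j %/ w i0))%N
  else (m i %% w i0)%N.

Lemma lincomb_concentrate (V : nmodType) (f : I -> V) m :
  lincomb f (concentrate m) = f i0 *+ m i0 +
    \sum_(i | i != i0) (f i0 *+ (w i * (m i %/ w i0)) + f i *+ (m i %% w i0)).
Proof.
rewrite (lincombD1 _ i0) {1}/concentrate eqxx mulrnDr -addrA; congr (_ + _).
rewrite big_split -sumrMnr; congr (_ + _).
by apply: eq_bigr => i /negbTE ni0; rewrite /concentrate ni0.
Qed.

Lemma improvement_concentrate m : improvement w p m (concentrate m).
Proof.
split; rewrite lincomb_concentrate (lincombD1 _ i0); last rewrite lerD2l.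
  congr (_ + _); apply: eq_bigr => i _.
  by rewrite [in RHS](divn_eq (m i) (w i0)); lia.
apply: ler_sum => i _; rewrite {1}(divn_eq (m i) (w i0)) mulrnDr lerD2r.
by rewrite [(_ * w i0)%N]mulnC !mulrnA; exact/ler_wMn2r/best_i0.
Qed.

Variable u : nat.
Hypothesis w_le : forall i, (w i <= u)%N.

Lemma other_weight_concentrate m :
  (\sum_(i | i != i0) w i * concentrate m i <= #|support m| * (u * u))%N.
Proof.
rewrite -sum_nat_const big_mkcond [leqRHS]big_mkcond; apply: leq_sum => i _.
rewrite inE /concentrate; case: (i == i0) => //=; case: posnP => [->|_].
  by rewrite mod0n muln0.
by rewrite leq_mul // (leq_trans (ltnW (ltn_pmod _ _))).
Qed.

Lemma small_other_weight m :
  exists2 m', improvement w p m m' &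
    (\sum_(i | i != i0) w i * m' i <= slack u * u)%N.
Proof.
have [m1 imp_m1 small_m1] := small_support p w_gt0 w_le m.
exists (concentrate m1).
  exact: improvement_trans imp_m1 (improvement_concentrate m1).
apply: leq_trans (other_weight_concentrate m1) _.
by rewrite mulnA !leq_mul2r small_m1 !orbT.
Qed.

Lemma optimal_add_best k t v : 0 <= p i0 -> (slack u * u <= t)%N ->
  optimal t v -> optimal (t + k * w i0) (v + p i0 *+ k).
Proof.
move=> p_ge0 le_t [ach_v dom_v]; split; first exact: achieves_add_copies.
apply: (dominates_wlog small_other_weight) => m small_m le_m.
pose m' i := if i == i0 then (m i0 - k)%N else m i.
have lincomb_m' (V : nmodType) (f : I -> V) :
    lincomb f m' = f i0 *+ (m i0 - k) + \sum_(i | i != i0) f i *+ m i.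
  rewrite (lincombD1 _ i0) {1}/m' eqxx; congr (_ + _).
  by apply: eq_bigr => i /negbTE ni0; rewrite /m' ni0.
have le_m' : (lincomb w m' <= t)%N.
  have small_rest : (\sum_(i | i != i0) w i *+ m i <= slack u * u)%N.
    by apply: leq_trans small_m; apply: leq_sum => i _; lia.
  rewrite lincomb_m'; move: le_m; rewrite (lincombD1 _ i0).
  move: (\sum_(i | _) _)%R small_rest => rest small_rest.
  case: (leqP k (m i0)) => [/subnKC <-|/ltnW/eqP->]; last by lia.
  by rewrite addKn; lia.
apply: le_trans (_ : lincomb p m' + p i0 *+ k <= _); last first.
  by rewrite lerD2r dom_v.
rewrite lincomb_m' (lincombD1 _ i0) addrAC lerD2r -mulrnDr.
by apply: ler_wpMn2l; rewrite // addnC -leq_subLR.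
Qed.

Definition spare_copies (t : nat) : nat := ((t - slack u * u) %/ w i0)%N.

Lemma weight_spare_copies_le t :
  (spare_copies t * w i0 <= t - slack u * u)%N.
Proof. exact: leq_trunc_div. Qed.

Lemma capacity_spare_copies_le t :
  (t - spare_copies t * w i0 <= slack u * u + u)%N.
Proof.
have := ltn_ceil (t - slack u * u) (w_gt0 i0); have := w_le i0.
by rewrite -/(spare_copies t) mulSn; lia.
Qed.

Lemma optimal_spare_copies t v : 0 <= p i0 ->
  optimal (t - spare_copies t * w i0) v ->
  optimal t (v + p i0 *+ spare_copies t).
Proof.
move=> p_ge0; case: (leqP t (slack u * u)) => [/eqP small_t|large_t].
  by rewrite /spare_copies small_t div0n subn0 addr0.
have le_k := weight_spare_copies_le t.
move=> /(optimal_add_best (spare_copies t) p_ge0).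
by rewrite subnK; [apply; lia | lia].
Qed.

End Optima.

(** * Tables of optimal profits *)

Section Tables.

Variables (I : finType) (R : realDomainType) (w : I -> nat) (p : I -> R).

Definition add_item (S : nat) (F : nat -> R) (i : I) (y : nat) : R :=
  if (y + w i < S)%N then Num.max (F y) (F (y + w i)%N + p i) else F y.

Definition add_items (S : nat) (F : nat -> R) (s : seq I) : nat -> R :=
  foldl (add_item S) F s.

Definition doubled (T : nat) (F : nat -> R) (y : nat) : R :=
  F (T %/ 2 - (T - y) %/ 2)%N *+ 2.

Lemma add_item_ge S F i y : F y <= add_item S F i y.
Proof. by rewrite /add_item; case: ifP; rewrite // le_max lexx. Qed.

Lemma add_item_ge_shift S F i y : (y + w i < S)%N ->
  F (y + w i)%N + p i <= add_item S F i y.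
Proof. by rewrite /add_item => ->; rewrite le_max lexx orbT. Qed.

Lemma add_items_ge S F s (A : {set I}) y : {subset A <= s} ->
  (y + \sum_(i in A) w i < S)%N ->
  F (y + \sum_(i in A) w i)%N + \sum_(i in A) p i <= add_items S F s y.
Proof.
elim: s F A y => [|i s IH] F A y sAs lt_S /=.
  have -> : A = set0 by apply/setP => i; rewrite inE; apply/negP => /sAs.
  by rewrite !big_set0 addn0 addr0.
have sAs' : {subset A :\ i <= s}.
  by move=> j; rewrite !inE => /andP[/negbTE ji /sAs]; rewrite inE ji.
apply: le_trans (IH _ (A :\ i) y sAs' _); last first.
  apply: leq_ltn_trans lt_S.
  by rewrite leq_add2l [leqRHS](big_setID [set i]) leq_addl.
case: (boolP (i \in A)) => iA; last first.
  have -> : A :\ i = A by apply/setDidPl; rewrite disjoint_sym disjoints1.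
  by rewrite lerD2r add_item_ge.
move: lt_S; rewrite !(big_setD1 i iA) addrA lerD2r /= => lt_S.
rewrite [(w i + _)%N]addnC addnA; apply: add_item_ge_shift; lia.
Qed.

Lemma add_item_achieves T S F i : (S <= T.+1)%N ->
  (forall y, y < S -> achieves w p (T - y) (F y))%N ->
  (forall y, y < S -> achieves w p (T - y) (add_item S F i y))%N.
Proof.
move=> le_S achF y lt_y; rewrite /add_item; case: ifP => lt_S; last exact: achF.
rewrite maxEle; case: ifP => _; last exact: achF.
have := achieves_add_copies i 1 (achF _ lt_S).
by apply: achieves_le; lia.
Qed.

Lemma add_items_achieves T S F s : (S <= T.+1)%N ->
  (forall y, y < S -> achieves w p (T - y) (F y))%N ->
  (forall y, y < S -> achieves w p (T - y) (add_items S F s y))%N.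
Proof.
move=> le_S; elim: s F => [|i s IH] F achF //=.
by apply: IH; exact: add_item_achieves.
Qed.

Variable D : nat.

Definition table_size (T : nat) : nat := minn (2 * D + 2) T.+1.

(* Entry y of the table at level T is for capacity T - y.  All entries are
   achievable, but only the first [D + 2] need be optimal: adding an item
   ignores what lies beyond the window, which is wide enough for the entries
   read at the next level. *)
Definition good_table (T : nat) (F : nat -> R) :=
  (forall y, y < table_size T -> achieves w p (T - y) (F y))%N /\
  (forall y, y < minn (D + 2) T.+1 -> dominates w p (T - y) (F y))%N.

Lemma optimal_good_table T F : good_table T F -> optimal w p T (F 0%N).
Proof.
move=> [ach dom]; rewrite -[T in optimal _ _ T]subn0.
by split; [apply: ach; rewrite /table_size | apply: dom]; lia.
Qed.

Lemma good_table0 F : (forall i, 0 < w i)%N -> F 0%N = 0 -> good_table 0 F.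
Proof.
move=> w_gt0 F0; have [ach dom] := optimal0 p w_gt0.
by split=> [] [|y]; rewrite ?F0 // leq_min ltnS andbF.
Qed.

Lemma half_table_index T y : (y < table_size T ->
  T %/ 2 - (T - y) %/ 2 < minn (D + 2) (T %/ 2).+1)%N.
Proof. rewrite /table_size; lia. Qed.

Lemma eq_doubled T F G :
  (forall y, (y < table_size (T %/ 2))%N -> F y = G y) ->
  forall y, (y < table_size T)%N -> doubled T F y = doubled T G y.
Proof.
move=> eqFG y /half_table_index lt_z; congr (_ *+ 2); apply: eqFG.
by apply: leq_trans lt_z _; rewrite /table_size; lia.
Qed.

Lemma half_table_capacity T y : (y < table_size T ->
  T %/ 2 - (T %/ 2 - (T - y) %/ 2) = (T - y) %/ 2)%N.
Proof. rewrite /table_size; lia. Qed.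

Lemma doubled_achieves T F y : good_table (T %/ 2) F -> (y < table_size T)%N ->
  achieves w p (T - y) (doubled T F y).
Proof.
move=> [achF _] lt_y; have lt_z := half_table_index lt_y.
have := achF (T %/ 2 - (T - y) %/ 2)%N; rewrite half_table_capacity //.
move=> /(_ _)/achieves_double ach; apply: achieves_le (ach _); first by lia.
by rewrite /table_size; lia.
Qed.

Lemma doubled_dominates T F y m : good_table (T %/ 2) F ->
  let odd_weight := (\sum_(i in odd_support m) w i)%N in
  (y + odd_weight < table_size T)%N -> (lincomb w m <= T - y)%N ->
  lincomb p m <=
    doubled T F (y + odd_weight) + \sum_(i in odd_support m) p i.
Proof.
move=> [_ domF] odd_weight lt_y le_m.
rewrite lincomb_halves lerD2r; apply/ler_wMn2r/domF.
  exact: half_table_index.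
rewrite half_table_capacity //; move: le_m; rewrite lincomb_halves.
by rewrite -/odd_weight; lia.
Qed.

Hypothesis odd_weight_le : odd_weight_wlog w p D.

Lemma good_table_double T F : good_table (T %/ 2) F ->
  good_table T (add_items (table_size T) (doubled T F) (enum I)).
Proof.
move=> goodF; split.
  apply: add_items_achieves => [|y]; first exact: geq_minr.
  exact: doubled_achieves.
move=> y lt_y; apply: (dominates_wlog odd_weight_le) => m le_D le_m.
have lt_S : (y + \sum_(i in odd_support m) w i < table_size T)%N.
  have odd_le : (\sum_(i in odd_support m) w i <= T - y)%N.
    by apply: leq_trans le_m; rewrite lincomb_halves leq_addl.
  by rewrite /table_size; lia.
apply: le_trans (doubled_dominates goodF lt_S le_m) _.
by apply: add_items_ge => // i; rewrite mem_enum.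
Qed.

End Tables.

(** * Program logic *)

Lemma modn_sub_wrap d x y : (y <= x)%N -> (x < d)%N ->
  ((x + (d - y)) %% d = x - y)%N.
Proof.
move=> le_yx lt_x; have -> : (x + (d - y) = x - y + d)%N by lia.
by rewrite modnDr modn_small //; lia.
Qed.

Arguments upd T f a v x /.

Local Coercion Instr : instr >-> cmd.
Local Notation "c1 ;; c2" := (Seq c1 c2) (at level 61, right associativity).

Fixpoint modified_wregs (c : cmd) : seq reg :=
  match c with
  | Instr (WConst d _ | WMove d _ | WOp _ d _ _ | WLoad d _) => [:: d]
  | Instr _ => [::]
  | Seq c1 c2 | If _ c1 c2 => modified_wregs c1 ++ modified_wregs c2
  | While _ c => modified_wregs c
  end.

Fixpoint modified_rregs (c : cmd) : seq reg :=
  match c with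
  | Instr (RMove d _ | ROp _ d _ _ | RLoad d _ | ROfWord d _) => [:: d]
  | Instr _ => [::]
  | Seq c1 c2 | If _ c1 c2 => modified_rregs c1 ++ modified_rregs c2
  | While _ c => modified_rregs c
  end.

Fixpoint stores_words (c : cmd) : bool :=
  match c with
  | Instr i => if i is WStore _ _ then true else false
  | Seq c1 c2 | If _ c1 c2 => stores_words c1 || stores_words c2
  | While _ c => stores_words c
  end.

Fixpoint stores_reals (c : cmd) : bool :=
  match c with
  | Instr i => if i is RStore _ _ then true else false
  | Seq c1 c2 | If _ c1 c2 => stores_reals c1 || stores_reals c2
  | While _ c => stores_reals c
  end.

Definition For (one i hi : reg) (c : cmd) : cmd :=
  While (WLt i hi) (c ;; WConst one 1 ;; WOp WAdd i i one).

Definition advance (R : Type) (one i : reg) (v : nat) (s : state R) : state R :=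
  State (upd (upd (wreg s) one 1%N) i v) (wmem s) (rreg s) (rmem s).

Arguments advance R one i v s /.

Section Runs.

Variables (R : realFieldType) (b : nat).
Implicit Types (s : state R) (Q : state R -> Prop).

Definition frame (c : cmd) s s' : Prop :=
  [/\ forall r, r \notin modified_wregs c -> wreg s' r = wreg s r,
      ~~ stores_words c -> wmem s' = wmem s,
      forall r, r \notin modified_rregs c -> rreg s' r = rreg s r &
      ~~ stores_reals c -> rmem s' = rmem s].

Lemma frame_refl c s : frame c s s.
Proof. by []. Qed.

Lemma frame_trans c s2 s1 s3 : frame c s1 s2 -> frame c s2 s3 -> frame c s1 s3.
Proof.
move=> [W12 M12 X12 Y12] [W23 M23 X23 Y23].
split=> [r keep|keep|r keep|keep].
- by rewrite W23 ?W12.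
- by rewrite M23 ?M12.
- by rewrite X23 ?X12.
- by rewrite Y23 ?Y12.
Qed.

Lemma frame_weaken c c' s s' :
  {subset modified_wregs c <= modified_wregs c'} ->
  (stores_words c -> stores_words c') ->
  {subset modified_rregs c <= modified_rregs c'} ->
  (stores_reals c -> stores_reals c') ->
  frame c s s' -> frame c' s s'.
Proof.
move=> subW subM subX subY [fW fM fX fY]; split=> [r|keep|r|keep].
- by move=> /(contra (subW r)); exact: fW.
- exact/fM/(contra subM keep).
- by move=> /(contra (subX r)); exact: fX.
- exact/fY/(contra subY keep).
Qed.

Lemma frame_seql c1 c2 s s' : frame c1 s s' -> frame (c1 ;; c2) s s'.
Proof.
by apply: frame_weaken => [r|/= ->|r|/= ->] //=; rewrite mem_cat => ->.
Qed.

Lemma frame_seqr c1 c2 s s' : frame c2 s s' -> frame (c1 ;; c2) s s'.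
Proof.
by apply: frame_weaken => [r|/= ->|r|/= ->] //=;
  rewrite ?mem_cat ?orbT // => ->; rewrite orbT.
Qed.

Lemma exec_frame c s k s' : exec b c s k s' -> frame c s s'.
Proof.
elim=> {c s k s'} //.
- move=> i [W M X Y]; case: i => *; split=> //= r;
    by rewrite inE => /negbTE->.
- move=> c1 c2 s s1 s2 k1 k2 _ f1 _ f2.
  exact: frame_trans (frame_seql _ f1) (frame_seqr _ f2).
- by move=> q c1 c2 s s1 k _ _ /(frame_seql c2).
- by move=> q c1 c2 s s1 k _ _ /(frame_seqr c1).
- by move=> q c s s1 s2 k1 k2 _ _ f1 _ f2; apply: frame_trans f1 f2.
Qed.

Definition runs (c : cmd) s (k : nat) Q : Prop :=
  exists k' s', [/\ exec b c s k' s', (k' <= k)%N & Q s'].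

Lemma runs_weaken c s k1 k2 Q1 Q2 :
  runs c s k1 Q1 -> (k1 <= k2)%N ->
  (forall s', frame c s s' -> Q1 s' -> Q2 s') -> runs c s k2 Q2.
Proof.
move=> [k [s' [run_c le_k Q1s']]] le_k2 Q12; exists k, s'.
by split; [|exact: leq_trans le_k2|exact: Q12 (exec_frame run_c) Q1s'].
Qed.

Lemma runs_instr (i : instr) s k Q :
  Q (instr_eval b i s) -> (0 < k)%N -> runs i s k Q.
Proof.
move=> Qs k_gt0; exists 1%N, (instr_eval b i s).
by split=> //; exact: ExecInstr.
Qed.

Lemma runs_seq k1 k Q1 c1 c2 s Q :
  runs c1 s k1 Q1 ->
  (forall s1, frame c1 s s1 -> Q1 s1 -> runs c2 s1 (k - k1) Q) ->
  (k1 <= k)%N -> runs (c1 ;; c2) s k Q.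
Proof.
move=> [k1' [s1 [run1 le_k1 Q1s1]]] run2 le_k.
have [k2 [s2 [run2' le_k2 Qs2]]] := run2 _ (exec_frame run1) Q1s1.
by exists (k1' + k2)%N, s2; split=> //; [exact: ExecSeq run1 run2' | lia].
Qed.

Lemma runs_step (i : instr) c s k Q :
  runs c (instr_eval b i s) (k - 1) Q -> (0 < k)%N -> runs (i ;; c) s k Q.
Proof.
move=> run_c k_gt0.
apply: (runs_seq (k1 := 1) (Q1 := eq (instr_eval b i s))) => //.
- exact: runs_instr.
- by move=> _ _ <-.
Qed.

Lemma runs_if q c1 c2 s k Q :
  (test_eval q s -> runs c1 s (k - 1) Q) ->
  (~~ test_eval q s -> runs c2 s (k - 1) Q) ->
  (0 < k)%N -> runs (If q c1 c2) s k Q.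
Proof.
move=> run1 run2 k_gt0; case: (boolP (test_eval q s)) => test_q.
  have [k' [s' [run_c le_k' Qs']]] := run1 test_q.
  by exists k'.+1, s'; split=> //; [exact: ExecIfT | lia].
have [k' [s' [run_c le_k' Qs']]] := run2 test_q.
by exists k'.+1, s'; split=> //; [exact: ExecIfF | lia].
Qed.

Lemma runs_while (Inv : nat -> state R -> Prop) N K q c s :
  (forall j s', (j < N)%N -> frame c s s' -> Inv j s' ->
    test_eval q s' /\ runs c s' K (Inv j.+1)) ->
  (forall s', frame c s s' -> Inv N s' -> ~~ test_eval q s') ->
  Inv 0%N s -> runs (While q c) s (N * K.+1 + 1) (Inv N).
Proof.
move=> body stop.
suff loop d j s' : (j + d = N)%N -> frame c s s' -> Inv j s' ->
    runs (While q c) s' (d * K.+1 + 1) (Inv N).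
  by apply: loop; rewrite ?frame_refl.
elim: d j s' => [|d IH] j s'.
  rewrite addn0 => -> fr Inv_s'.
  by exists 1%N, s'; split=> //; apply: ExecWhileF; exact: stop.
move=> jd fr Inv_j; have lt_j : (j < N)%N by lia.
have [test_q [k1 [s1 [run1 le_k1 Inv_s1]]]] := body j s' lt_j fr Inv_j.
have [||k2 [s2 [run2 le_k2 Inv_s2]]] := IH j.+1 s1 _ _ Inv_s1; first by lia.
  exact: frame_trans fr (exec_frame run1).
exists (k1 + k2).+1, s2; split=> //; last by rewrite mulSn; lia.
exact: ExecWhileT run1 run2.
Qed.

Lemma runs_for (Inv : nat -> state R -> Prop) lo N K (one i hi : reg) c s k Q :
  [&& i \notin one :: hi :: modified_wregs c &
      hi \notin one :: modified_wregs c] ->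
  wreg s i = lo -> wreg s hi = N -> (1 < 2 ^ b)%N -> (N < 2 ^ b)%N ->
  Inv lo s ->
  (forall j s', (lo <= j < N)%N -> frame (For one i hi c) s s' ->
    wreg s' i = j -> Inv j s' ->
    runs c s' K (fun s1 => Inv j.+1 (advance one i j.+1 s1))) ->
  (forall s', frame (For one i hi c) s s' -> Inv (maxn lo N) s' -> Q s') ->
  ((N - lo) * (K + 3) + 1 <= k)%N ->
  runs (For one i hi c) s k Q.
Proof.
rewrite !inE !negb_or => /and3P[/and3P[i_one i_hi i_c] hi_one hi_c].
move=> s_i s_hi b_gt1 lt_N Inv_lo body post le_k.
have hi_i : (hi == i) = false by rewrite eq_sym (negbTE i_hi).
have frame_hi s' : frame (For one i hi c) s s' -> wreg s' hi = N.
  move=> [fW _ _ _]; rewrite fW //= mem_cat !inE.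
  by rewrite (negbTE hi_c) (negbTE hi_one) hi_i.
pose Inv' j s' := Inv (lo + j)%N s' /\ wreg s' i = (lo + j)%N.
apply: (@runs_weaken _ _ ((N - lo) * (K + 2).+1 + 1) _ (Inv' (N - lo)%N));
  last first.
- by move=> s' fr []; rewrite -maxnE => /(post _ fr).
- by rewrite -addnS in le_k *.
apply: runs_while; last by split; rewrite addn0.
- move=> j s' lt_j fr [Inv_j s'_i]; rewrite /= s'_i frame_hi //.
  split; first by lia.
  apply: (runs_seq (body _ _ _ fr s'_i Inv_j)); [by lia| |by lia].
  move=> [W M X Y] [/= fW _ _ _] Inv_s1; apply: runs_step; last by lia.
  apply: runs_instr; last by lia.
  rewrite /= eqxx (negbTE i_one) fW // s'_i (modn_small b_gt1) addn1 modn_small;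
    last by lia.
  by split; rewrite /= ?eqxx addnS.
- by move=> s' fr [_ s'_i]; rewrite /= s'_i frame_hi // -leqNgt; lia.
Qed.

End Runs.

Ltac step := apply: runs_step; [rewrite /= | by [] || lia].

(** * The program *)

Local Notation rItems := 0%N (only parsing).
Local Notation rCapacity := 1%N (only parsing).
Local Notation rOne := 2%N (only parsing).
Local Notation rMaxWeight := 3%N (only parsing).
Local Notation rItem := 4%N (only parsing).
Local Notation rWeight := 5%N (only parsing).
Local Notation rBest := 6%N (only parsing).
Local Notation rBestWeight := 7%N (only parsing).
Local Notation rNumber := 8%N (only parsing).
Local Notation rBits := 9%N (only parsing).
Local Notation rPower := 10%N (only parsing).
Local Notation rZero := 11%N (only parsing).
Local Notation rTwo := 12%N (only parsing).
Local Notation rBound := 13%N (only parsing).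
Local Notation rWindow := 14%N (only parsing).
Local Notation rCopies := 15%N (only parsing).
Local Notation rLevel := 16%N (only parsing).
Local Notation rLevelCapacity := 17%N (only parsing).
Local Notation rPrevCapacity := 18%N (only parsing).
Local Notation rSize := 19%N (only parsing).
Local Notation rStep := 20%N (only parsing).
Local Notation rEntry := 21%N (only parsing).
Local Notation rSrc := 22%N (only parsing).
Local Notation rDst := 23%N (only parsing).
Local Notation rEnd := 24%N (only parsing).
Local Notation rLast := 25%N (only parsing).

Local Notation xOut := 0%N (only parsing).
Local Notation xProfit := 1%N (only parsing).
Local Notation xBestProfit := 2%N (only parsing).
Local Notation xCandidate := 3%N (only parsing).
Local Notation xCurrent := 4%N (only parsing).
Local Notation xTaken := 5%N (only parsing).

Lemma arrayE (T : Type) (n : nat) (z : T) (f : 'I_n -> T) (i : 'I_n) :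
  array z f i = f i.
Proof. by rewrite /array valK. Qed.

Definition find_max_weight : cmd :=
  (WConst rMaxWeight 0 ;; WConst rItem 0 ;;
   For rOne rItem rItems
     (WLoad rWeight rItem ;;
      If (WLt rMaxWeight rWeight)
        (WMove rMaxWeight rWeight)
        (WMove rMaxWeight rMaxWeight)))%N.

Definition find_best_item : cmd :=
  (WConst rBest 0 ;; WConst rItem 0 ;;
   For rOne rItem rItems
     (WLoad rWeight rItem ;; RLoad xProfit rItem ;;
      WLoad rBestWeight rBest ;; RLoad xBestProfit rBest ;;
      ROfWord xCurrent rWeight ;; ROp RMul xCurrent xBestProfit xCurrent ;;
      ROfWord xCandidate rBestWeight ;;
      ROp RMul xCandidate xProfit xCandidate ;;
      If (RLt xCurrent xCandidate) (WMove rBest rItem) (WMove rBest rBest)))%N.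

Definition count_bits : cmd :=
  (WConst rZero 0 ;; WConst rOne 1 ;; WConst rTwo 2 ;;
   WConst rBits 0 ;; WConst rPower 1 ;;
   While (WLt rZero rNumber)
     (WOp WDiv rNumber rNumber rTwo ;; WOp WAdd rBits rBits rOne ;;
      WOp WMul rPower rPower rTwo))%N.

Definition set_bounds : cmd :=
  (WMove rNumber rMaxWeight ;; count_bits ;; WConst rTwo 2 ;;
   WOp WMul rBound rTwo rBits ;; WOp WMul rBound rBound rMaxWeight ;;
   WOp WMul rWindow rTwo rBound ;; WOp WAdd rWindow rWindow rTwo ;;
   WOp WMul rBound rBound rMaxWeight)%N.

Definition take_best_copies : cmd :=
  (WLoad rBestWeight rBest ;; RLoad xBestProfit rBest ;;
   If (WLt rBound rCapacity)
     (WOp WSub rCopies rCapacity rBound ;; WOp WDiv rCopies rCopies rBestWeight)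
     (WConst rCopies 0) ;;
   WOp WMul rBestWeight rCopies rBestWeight ;;
   WOp WSub rCapacity rCapacity rBestWeight ;;
   ROfWord xTaken rCopies ;; ROp RMul xTaken xBestProfit xTaken)%N.

(* Entry y is computed from an entry of index at most y, so the table can be
   updated in place from its end. *)
Definition double_table : cmd :=
  (WConst rOne 1 ;; WOp WSub rLast rSize rOne ;;
   WConst rTwo 2 ;; WConst rStep 0 ;;
   For rOne rStep rSize
     (WOp WSub rEntry rLast rStep ;;
      WOp WSub rSrc rLevelCapacity rEntry ;; WOp WDiv rSrc rSrc rTwo ;;
      WOp WSub rSrc rPrevCapacity rSrc ;; WOp WAdd rSrc rItems rSrc ;;
      RLoad xCandidate rSrc ;; ROp RAdd xCandidate xCandidate xCandidate ;;
      WOp WAdd rDst rItems rEntry ;; RStore rDst xCandidate))%N.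

(* Ascending addresses are read before they are written, so that each item is
   used at most once. *)
Definition relax_item : cmd :=
  For rOne rSrc rEnd
    (RLoad xCandidate rSrc ;; ROp RAdd xCandidate xCandidate xProfit ;;
     WOp WSub rDst rSrc rWeight ;; RLoad xCurrent rDst ;;
     If (RLt xCurrent xCandidate)
       (RStore rDst xCandidate)
       (RStore rDst xCurrent))%N.

Definition relax_items : cmd :=
  (WConst rItem 0 ;; WOp WAdd rEnd rItems rSize ;;
   For rOne rItem rItems
     (WLoad rWeight rItem ;; RLoad xProfit rItem ;;
      WOp WAdd rSrc rItems rWeight ;; relax_item))%N.

Definition next_level : cmd :=
  (WConst rTwo 2 ;; WOp WDiv rPower rPower rTwo ;;
   WMove rPrevCapacity rLevelCapacity ;;
   WOp WDiv rLevelCapacity rCapacity rPower ;;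
   WConst rOne 1 ;; WOp WAdd rSize rLevelCapacity rOne ;;
   If (WLt rWindow rSize) (WMove rSize rWindow) (WMove rSize rSize) ;;
   double_table ;; relax_items)%N.

Definition solve_by_halving : cmd :=
  (WMove rNumber rCapacity ;; count_bits ;;
   WConst rLevelCapacity 0 ;;
   ROfWord xOut rLevelCapacity ;; RStore rItems xOut ;;
   WConst rLevel 0 ;; For rOne rLevel rBits next_level ;;
   RLoad xOut rItems)%N.

Definition reduce_capacity : cmd :=
  find_max_weight ;; find_best_item ;; set_bounds ;; take_best_copies.

Definition knapsack : cmd :=
  (reduce_capacity ;; solve_by_halving ;; ROp RAdd xOut xOut xTaken)%N.

Section Memory.

Variables (R : realFieldType) (n : nat) (w : 'I_n -> nat) (p : 'I_n -> R).
Implicit Types (s : state R) (F : nat -> R).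

Definition has_input s : Prop :=
  [/\ wreg s rItems = n, forall i : 'I_n, wmem s i = w i &
      forall i : 'I_n, rmem s i = p i].

Definition has_table (S : nat) F s : Prop :=
  has_input s /\ forall y, (y < S)%N -> rmem s (n + y)%N = F y.

Lemma has_input_frame c s s' : frame c s s' ->
  [&& rItems \notin modified_wregs c, ~~ stores_words c & ~~ stores_reals c] ->
  has_input s -> has_input s'.
Proof.
move=> [fW fM _ fY] /and3P[keepW keepM keepY] [s_n s_w s_p].
by split; rewrite ?fW ?fM ?fY.
Qed.

Lemma has_table_update S F G (j : nat) v W W' M X X' Y :
  has_table S F (State W M X Y) -> W' rItems = n ->
  G j = v -> (forall y, (y < S)%N -> y != j -> G y = F y) ->
  has_table S G (State W' M X' (upd Y (n + j)%N v)).
Proof.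
move=> [[/= _ s_w s_p] /= YF] W'n Gj GF; split; first split=> //.
  by move=> i /=; rewrite -s_p ifN //; have := ltn_ord i; lia.
move=> y lt_y /=; rewrite eqn_add2l.
case: eqVneq => [->|ne_y]; first by rewrite Gj.
by rewrite GF // YF.
Qed.

Lemma eq_has_table S F G s :
  (forall y, (y < S)%N -> F y = G y) -> has_table S F s -> has_table S G s.
Proof. by move=> eqFG [s_in s_F]; split=> // y lt_y; rewrite s_F ?eqFG. Qed.

End Memory.

Section Loops.

Variables (R : realFieldType) (b n : nat) (w : 'I_n -> nat) (p : 'I_n -> R).
Implicit Types (s : state R) (F : nat -> R).

Hypothesis b_gt1 : (1 < 2 ^ b)%N.

Local Notation has_input := (has_input w p).
Local Notation has_table := (has_table w p).

Lemma runs_find_max_weight s : has_input s -> (n < 2 ^ b)%N ->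
  runs b find_max_weight s (n * 6 + 3)
    (fun s' => wreg s' rMaxWeight = max_weight w).
Proof.
case: s => W M X Y [/= Wn Mw _] lt_n; step; step; rewrite mod0n.
pose Inv j s := wreg s rMaxWeight = (\max_(0 <= a < j) M a)%N.
apply: (runs_for (Inv := Inv) (lo := 0%N) (N := n) (K := 3)) => //=.
- by rewrite /Inv big_geq.
- move=> j [W1 M1 X1 Y1] /= lt_j [/= _ -> // _ _] W1j Inv_j; step.
  rewrite /Inv big_nat_recr //= -Inv_j W1j.
  by apply: runs_if => //= cmp; apply: runs_instr => //=; lia.
- by move=> s' _; rewrite /Inv max0n big_mkord => ->; apply: eq_bigr => i _.
- lia.
Qed.

Lemma runs_find_best_item s : has_input s -> (0 < n)%N -> (n < 2 ^ b)%N ->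
  (forall i, 0 < w i)%N ->
  runs b find_best_item s (n * 13 + 3) (fun s' =>
    exists2 i0 : 'I_n, wreg s' rBest = i0 & best_ratio w p i0).
Proof.
case: s => W M X Y [/= Wn Mw Yp] n_gt0 lt_n w_gt0; step; step; rewrite mod0n.
pose Inv j s := exists2 i0 : 'I_n, wreg s rBest = i0 &
  forall i : 'I_n, (i < j)%N -> ratio_le w p i i0.
apply: (runs_for (Inv := Inv) (lo := 0%N) (N := n) (K := 10)) => //=.
- by exists (Ordinal n_gt0).
- move=> j [W1 M1 X1 Y1] /= lt_j [/= _ -> // _ -> //] W1j [i0 /= W1best best].
  pose i := Ordinal lt_j; do 8 step.
  rewrite W1best W1j -[j]/(val i) !Mw !Yp.
  have item_cases (k : 'I_n) : (k < i.+1)%N -> k = i \/ (k < i)%N.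
    by rewrite ltnS leq_eqVlt => /predU1P[/val_inj ->|]; [left|right].
  apply: runs_if => //= [/ltW|]; rewrite ?ltNge !mulr_natr ?negbK => cmp;
    apply: runs_instr => //=.
    exists i => //= k /item_cases[->|/best le_k]; first exact: lexx.
    exact: ratio_le_trans le_k cmp.
  by exists i0 => // k /item_cases[->|/best].
- move=> s' _ [i0 s'_best best]; exists i0 => // i.
  by apply: best; rewrite max0n.
- lia.
Qed.

Lemma runs_count_bits s z :
  wreg s rNumber = z -> (0 < z)%N -> (2 * z + 1 < 2 ^ b)%N ->
  runs b count_bits s (bits z * 4 + 6) (fun s' =>
    wreg s' rBits = bits z /\ wreg s' rPower = (2 ^ bits z)%N).
Proof.
case: s => W M X Y /= Wz z_gt0 lt_z.
do 5 step; rewrite mod0n modn_small // [(2 %% _)%N]modn_small; last by lia.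
pose Inv j s := [/\ wreg s rNumber = (z %/ 2 ^ j)%N, wreg s rBits = j &
  wreg s rPower = (2 ^ j)%N].
apply: (runs_weaken (runs_while (Inv := Inv) (K := 3) (N := bits z) _ _ _)).
- move=> j [W1 M1 X1 Y1] lt_j [/= fW _ _ _] [/= W1z W1j W1pow].
  have lt_j_exp := ltn_expl j (isT : 1 < 2)%N.
  rewrite ltn_bits // in lt_j.
  rewrite /= fW // W1z; split; first by rewrite divn_gt0 ?expn_gt0.
  do 2 step; apply: runs_instr => //=; rewrite W1z W1j W1pow !fW //.
  split=> /=; first by rewrite expnSr divnMA.
    by rewrite addn1 modn_small //; lia.
  by rewrite -expnSr modn_small // expnSr; lia.
- move=> [W1 M1 X1 Y1] [/= fW _ _ _] [/= W1z _ _].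
  by rewrite fW // W1z divn_small ?ltn_exp_bits.
- by split; rewrite //= Wz divn1.
- lia.
- by move=> s' _ [].
Qed.

Section Items.

Variable S : nat.
Hypothesis S_small : (n + S < 2 ^ b)%N.

Lemma runs_relax_item (i : 'I_n) F s : has_table S F s ->
  wreg s rSrc = (n + w i)%N -> wreg s rWeight = w i ->
  wreg s rEnd = (n + S)%N -> rreg s xProfit = p i ->
  runs b relax_item s (S * 9 + 1) (has_table S (add_item w p S F i)).
Proof.
move=> table_s s_src s_wi s_end s_pi.
pose Inv j := has_table S (fun y =>
  if (n + w i + y < j)%N then add_item w p S F i y else F y).
apply: (runs_for (Inv := Inv) (lo := (n + w i)%N) (N := (n + S)%N) (K := 6));
  rewrite //=.
- case: table_s => s_in s_F; split=> // y lt_y.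
  by rewrite s_F // ifN // -leqNgt leq_addr.
- move=> j [W M X Y] lt_j [/= fW _ fX _] W_src table_j.
  have [y jE] : exists y, j = (n + w i + y)%N by exists (j - (n + w i))%N; lia.
  have [[/= Wn _ _] YF] := table_j; rewrite {}jE in lt_j W_src table_j YF *.
  do 4 step; rewrite W_src fW // s_wi fX // s_pi.
  rewrite modn_sub_wrap; [|lia|lia].
  rewrite (_ : n + w i + y - w i = n + y)%N; last by lia.
  have -> : Y (n + w i + y)%N = F (y + w i)%N.
    by rewrite -addnA [(w i + y)%N]addnC YF ?ifN //; lia.
  have -> : Y (n + y)%N = F y by rewrite YF ?ltnn //; lia.
  have item_y : add_item w p S F i y =
      if F y < F (y + w i)%N + p i then F (y + w i)%N + p i else F y.
    by rewrite /add_item ifT //; lia.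
  have same_below z : z != y ->
      (n + w i + z < (n + w i + y).+1)%N = (n + w i + z < n + w i + y)%N by lia.
  by apply: runs_if => //= cmp; apply: runs_instr => //=;
    apply: (has_table_update _ table_j) => // [|z _ /same_below-> //];
    rewrite ltnS leqnn item_y ?cmp ?(negbTE cmp).
- move=> s' _ [s'_in s'_F]; split=> // y lt_y; rewrite s'_F //.
  by case: ifP => // large; rewrite /add_item ifN //; lia.
- by rewrite leq_add2r leq_mul2r; lia.
Qed.

Lemma runs_relax_items F s : has_table S F s -> wreg s rSize = S ->
  (n + max_weight w < 2 ^ b)%N ->
  runs b relax_items s (n * (S * 9 + 7) + 3)
    (has_table S (add_items w p S F (enum 'I_n))).
Proof.
case: s => W M X Y table_s /= s_size lt_u; have [[/= Wn _ _] _] := table_s.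
step; step; rewrite mod0n Wn s_size modn_small //.
pose Inv j := has_table S (add_items w p S F (take j (enum 'I_n))).
apply: (runs_for (Inv := Inv) (lo := 0%N) (N := n) (K := (S * 9 + 4)%N)) => //=.
- lia.
- by rewrite /Inv take0; case: table_s => [[_ Mw Yp] YF].
- move=> j [W1 M1 X1 Y1] lt_j [/= fW _ _ _] W1j table_j.
  pose i := Ordinal lt_j.
  have [[/= W1n M1w Y1p] _] := table_j.
  do 3 step; rewrite W1j W1n -[j]/(val i) M1w Y1p modn_small; last first.
    by apply: leq_ltn_trans lt_u; rewrite leq_add2l leq_bigmax.
  apply: runs_weaken.
  + by apply: (@runs_relax_item i (add_items w p S F (take j (enum 'I_n))));
      rewrite //= ?fW.
  + lia.
  + move=> s' _; rewrite /Inv (take_nth i) ?size_enum_ord // nth_ord_enum.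
    by rewrite /add_items foldl_rcons.
- by move=> s' _; rewrite /Inv max0n take_oversize ?size_enum_ord.
- lia.
Qed.

End Items.

Lemma runs_set_bounds s u : wreg s rMaxWeight = u -> (0 < u)%N ->
  (2 * slack u + slack u * u + 2 * u + 3 < 2 ^ b)%N ->
  runs b set_bounds s (bits u * 4 + 13) (fun s' =>
    wreg s' rBound = (slack u * u)%N /\ wreg s' rWindow = (2 * slack u + 2)%N).
Proof.
case: s => W M X Y /= W_u u_gt0 large; step.
have slack_bits : (2 * bits u <= slack u)%N by rewrite /slack leq_pmulr.
apply: (runs_seq (runs_count_bits (z := u) _ _ _)) => //=; [lia| |lia].
move=> [W1 M1 X1 Y1] [/= fW _ _ _] [W1bits _]; step.
rewrite modn_small; last by lia.
step; rewrite W1bits modn_small; last by lia.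
step; rewrite fW //= W_u -/(slack u) modn_small; last by lia.
step; rewrite modn_small; last by lia.
step; rewrite modn_small; last by lia.
apply: runs_instr; last by lia.
by rewrite /= fW //= W_u modn_small //; lia.
Qed.

Lemma runs_take_best_copies s t u (i0 : 'I_n) : has_input s ->
  wreg s rCapacity = t -> wreg s rBest = i0 ->
  wreg s rBound = (slack u * u)%N -> (t < 2 ^ b)%N ->
  runs b take_best_copies s 9 (fun s' =>
    wreg s' rCapacity = (t - spare_copies w i0 u t * w i0)%N /\
    rreg s' xTaken = p i0 *+ spare_copies w i0 u t).
Proof.
case: s => W M X Y [/= Wn Mw Yp] W_t W_best W_bound lt_t.
set k := spare_copies w i0 u t.
have le_k : (k * w i0 <= t - slack u * u)%N := weight_spare_copies_le w i0 u t.
do 2 step; rewrite W_best Mw Yp.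
pose copied (s : state R) := exists W1,
  s = State W1 M (upd X xBestProfit (p i0)) Y /\
  [/\ W1 rCapacity = t, W1 rBestWeight = w i0 & W1 rCopies = k].
apply: (runs_seq (k1 := 3) (Q1 := copied)) => //.
  apply: runs_if => //=; rewrite W_bound W_t => cmp.
    step; rewrite W_t W_bound modn_sub_wrap ?(ltnW cmp) //.
    by apply: runs_instr => //=; eexists.
  apply: runs_instr => //=; eexists; split; first by [].
  by rewrite /k /spare_copies mod0n (_ : t - _ = 0)%N ?div0n //; lia.
move=> _ _ [W1 [-> [W1t W1w W1k]]].
step; rewrite W1k W1w modn_small; last by lia.
step; rewrite W1t modn_sub_wrap; [|lia|lia].
by step; apply: runs_instr => //=; rewrite W1k mulr_natr.
Qed.

Lemma runs_double_table s S T : has_input s -> wreg s rSize = S ->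
  wreg s rLevelCapacity = T -> wreg s rPrevCapacity = (T %/ 2)%N ->
  (0 < S <= T.+1)%N -> (n + S < 2 ^ b)%N -> (T < 2 ^ b)%N -> (2 < 2 ^ b)%N ->
  runs b double_table s (S * 12 + 5)
    (has_table S (doubled T (fun y => rmem s (n + y)%N))).
Proof.
case: s => W M X Y s_in /= s_size s_top s_prev S_bounds lt_S lt_T b_gt2.
set F := (fun y => Y _).
step; rewrite modn_small //; step; rewrite s_size modn_sub_wrap; [|lia|lia].
do 2 step; rewrite mod0n modn_small //.
pose Inv j := has_table S
  (fun y => if (S <= y + j)%N then doubled T F y else F y).
apply: (runs_for (Inv := Inv) (lo := 0%N) (N := S) (K := 9)) => //=.
- lia.
- case: s_in => [/= Wn Mw Yp]; split=> // y lt_y.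
  by rewrite addn0 ifN //= -ltnNge.
- move=> j [W1 M1 X1 Y1] /= lt_j [/= fW _ _ _] W1j table_j.
  have [y Sj] : exists y, (S - 1 - j = y)%N by exists (S - 1 - j)%N.
  have [[/= W1n _ _] Y1F] := table_j.
  step; rewrite fW //= W1j modn_sub_wrap; [|lia|lia].
  rewrite Sj; step; rewrite fW //= s_top modn_sub_wrap; [|lia|lia].
  step; rewrite fW //=.
  step; rewrite fW //= s_prev modn_sub_wrap; [|lia|lia].
  step; rewrite W1n modn_small; last by lia.
  do 3 step; rewrite W1n modn_small; last by lia.
  apply: runs_instr => //=.
  rewrite Y1F; last by lia.
  rewrite ifN; last by lia.
  apply: (has_table_update _ table_j) => //=.
  + by rewrite ifT ?/doubled ?mulr2n //; lia.
  + by move=> z lt_z ne_z; congr (if _ then _ else _); lia.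
- move=> s' _ [s'_in s'_F]; split=> // y lt_y.
  by rewrite s'_F // max0n ifT //; lia.
- lia.
Qed.

Section Levels.

Variables t D : nat.

Definition level_solved (P : nat) s : Prop :=
  [/\ wreg s rPower = P, wreg s rLevelCapacity = (t %/ P)%N &
      exists2 F, good_table w p D (t %/ P) F &
        has_table (table_size D (t %/ P)) F s].

Definition level_time : nat := ((2 * D + 2) * (9 * n + 12) + 7 * n + 16)%N.

Hypothesis w_gt0 : forall i, (0 < w i)%N.
Hypothesis odd_weight_le : odd_weight_wlog w p D.
Hypotheses (window_small : (n + (2 * D + 2) < 2 ^ b)%N)
  (u_small : (n + max_weight w < 2 ^ b)%N) (t_small : (t + 1 < 2 ^ b)%N).

Lemma runs_next_level s P : (0 < P)%N -> level_solved (2 * P) s ->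
  wreg s rCapacity = t -> wreg s rWindow = (2 * D + 2)%N ->
  runs b next_level s level_time (level_solved P).
Proof.
case: s => W M X Y P_gt0 [/= W_pow W_top [F goodF tableF]] W_t W_window.
have b_gt2 : (2 < 2 ^ b)%N by lia.
set T := (t %/ P)%N; have le_T : (T <= t)%N by exact: leq_div.
have half_T : (t %/ (2 * P) = T %/ 2)%N by rewrite mulnC divnMA.
rewrite {}half_T in W_top goodF tableF.
have [[/= Wn Mw Yp] YF] := tableF.
set S := table_size D T.
have S_bounds : (0 < S <= T.+1)%N by rewrite /S /table_size; lia.
have S_le : (S <= 2 * D + 2)%N by exact: geq_minl.
have enough_time : (8 + (S * 12 + 5) + (n * (S * 9 + 7) + 3) <= level_time)%N.
  by rewrite /level_time; nia.
step; rewrite modn_small //; step; rewrite W_pow mulKn // -/T.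
do 2 step; rewrite W_t W_top -/T; step; rewrite modn_small //.
step; rewrite modn_small; last by lia.
pose sized (s : state R) := exists W1, s = State W1 M X Y /\
  [/\ W1 rItems = n, W1 rPower = P, W1 rLevelCapacity = T,
      W1 rPrevCapacity = (T %/ 2)%N & W1 rSize = S].
apply: (runs_seq (k1 := 2) (Q1 := sized)) => //; last by lia.
  by apply: runs_if => //= cmp; apply: runs_instr => //=; eexists; split=> //;
    split=> //=; rewrite /S /table_size -W_window; lia.
move=> _ _ [W1 [-> [W1n W1pow W1top W1prev W1size]]].
apply: (runs_seq (runs_double_table (S := S) (T := T) _ _ _ _ _ _ _ _));
  rewrite //=; try lia.
move=> s2 [/= f2W _ _ _] /(eq_has_table (eq_doubled YF)) table2.
apply: runs_weaken.
- by apply: (runs_relax_items (S := S) _ table2); rewrite ?f2W //; lia.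
- lia.
- move=> s3 [/= f3W _ _ _] table3; split; rewrite ?f3W ?f2W //.
  exists (add_items w p S (doubled T F) (enum 'I_n)) => //.
  exact: good_table_double.
Qed.

Lemma runs_solve_by_halving s : has_input s -> wreg s rCapacity = t ->
  wreg s rWindow = (2 * D + 2)%N -> (0 < t)%N -> (2 * t + 1 < 2 ^ b)%N ->
  runs b solve_by_halving s (bits t * (level_time + 7) + 14)
    (fun s' => optimal w p t (rreg s' xOut)).
Proof.
case: s => W M X Y [/= Wn Mw Yp] W_t W_window t_gt0 t2_small.
step; apply: (runs_seq (runs_count_bits (z := t) _ _ _)) => //=; last by lia.
move=> [W1 M1 X1 Y1] [/= f1W f1M _ f1Y] [W1bits W1pow].
rewrite {M1}f1M // {Y1}f1Y //.
do 4 step; rewrite !mod0n f1W //= Wn.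
apply: (runs_seq (k1 := (bits t * (level_time + 3) + 1)%N)
  (Q1 := level_solved 1)); last by lia.
- pose Inv j := level_solved (2 ^ (bits t - j)).
  apply: (runs_for (Inv := Inv) (lo := 0%N) (N := bits t) (K := level_time));
    rewrite //=.
  + have := ltn_expl (bits t) (isT : 1 < 2)%N; have := leq_exp_bits t_gt0.
    by lia.
  + rewrite /Inv subn0; split; rewrite //= ?divn_small ?ltn_exp_bits //.
    exists (fun=> 0); first exact: good_table0.
    split; last first.
      by move=> y; rewrite /table_size => lt_y /=; rewrite ifT //; lia.
    by split=> //= [|i]; [rewrite f1W | rewrite ifN // neq_ltn ltn_ord].
  + move=> j s' lt_j [/= fW _ _ _] s'_level Inv_j.
    apply: runs_weaken.
    * apply: (runs_next_level (P := 2 ^ (bits t - j.+1))); rewrite ?expn_gt0 //.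
      - by rewrite -expnS subnSK.
      - by rewrite fW //= f1W.
      - by rewrite fW //= f1W.
    * by [].
    * by move=> [W3 M3 X3 Y3].
  + by move=> s' _; rewrite /Inv max0n subnn.
- move=> s2 _ [_ _]; rewrite divn1 => [[F goodF [[s2n _ _] s2F]]].
  apply: runs_instr; last by lia.
  case: s2 s2n s2F => W2 M2 X2 Y2 /= -> Y2F.
  have -> : Y2 n = F 0%N by rewrite -[X in Y2 X]addn0 Y2F // /table_size; lia.
  exact: optimal_good_table goodF.
Qed.

End Levels.

End Loops.

(** * Running time *)

Lemma bits_reduced_capacity_le u t : (0 < t)%N -> (t <= slack u * u + u)%N ->
  (bits t <= 4 * bits u)%N.
Proof.
move=> t_gt0 le_t; rewrite leq_bits //.
have lt_u := ltn_exp_bits u; have lt_L := ltn_expl (bits u) (isT : 1 < 2)%N.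
have -> : (2 ^ (4 * bits u) = (2 ^ bits u) ^ 4)%N by rewrite mulnC expnM.
apply: leq_ltn_trans le_t _; rewrite /slack.
move: (2 ^ bits u)%N lt_u lt_L => Z lt_u lt_L.
have Z_ge2 : (2 <= Z)%N by have : (0 < bits u)%N by []; lia.
have -> : (2 * bits u * u * u + u = (2 * (bits u * u) + 1) * u)%N by lia.
have le_Lu : (bits u * u <= Z.-1 * Z.-1)%N by apply: leq_mul; lia.
apply: (@leq_ltn_trans ((2 * (Z.-1 * Z.-1) + 1) * Z.-1)%N).
  by apply: leq_mul; lia.
rewrite !expnS expn0; nia.
Qed.

Lemma running_time_le n u : (0 < n)%N -> (0 < u)%N ->
  (19 * n + 4 * bits u + 4 * bits u * (level_time n (slack u) + 7) + 43 <=
   2760 * (n * u * log u ^ 2))%N.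
Proof.
move=> n_gt0 u_gt0; have L_gt0 : (0 < bits u)%N by [].
have le_level : (level_time n (slack u) + 7 <= 156 * (n * (bits u * u)))%N.
  have v_gt0 : (0 < bits u * u)%N by rewrite muln_gt0 L_gt0.
  rewrite /level_time /slack -mulnA; move: (bits u * u)%N v_gt0 => v v_gt0; nia.
apply: (@leq_trans (690 * (n * u * bits u ^ 2))); last first.
  have : (n * u * bits u ^ 2 <= n * u * (2 * log u) ^ 2)%N.
    by rewrite leq_mul // leq_sqr leq_bits_log.
  by rewrite expnMn; lia.
have : (4 * bits u * (level_time n (slack u) + 7) <=
        624 * (n * u * bits u ^ 2))%N.
  apply: leq_trans (leq_mul (leqnn _) le_level) _.
  by rewrite expnS expn1; lia.
have : (n <= n * u * bits u ^ 2)%N.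
  by rewrite -mulnA leq_pmulr // muln_gt0 u_gt0 expn_gt0.
have : (bits u <= n * u * bits u ^ 2)%N.
  by rewrite expnS expn1 mulnA leq_pmull // !muln_gt0 n_gt0 u_gt0.
lia.
Qed.

Lemma word_size_suffices n u t b : (0 < n)%N -> (0 < u)%N -> (0 < t)%N ->
  (6 * bits (n + u + t) <= b)%N ->
  (n + 2 * slack u + slack u * u + 2 * u + 2 * t + 5 < 2 ^ b)%N.
Proof.
move=> n_gt0 u_gt0 t_gt0 le_b; set N := (2 ^ bits (n + u + t))%N.
have lt_N : (n + u + t < N)%N := ltn_exp_bits _.
have le_L : (bits u <= u)%N by rewrite leq_bits // ltn_expl.
have N6_le : (N ^ 6 <= 2 ^ b)%N by rewrite -expnM mulnC leq_exp2l.
apply: leq_trans N6_le.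
have le_slack : (slack u <= 2 * (N * N))%N.
  by rewrite /slack -mulnA leq_mul // leq_mul; lia.
have le_bound : (slack u * u <= 2 * (N * N * N))%N.
  by rewrite !mulnA in le_slack *; rewrite leq_mul //; lia.
move: (slack u * u)%N le_bound (slack u) le_slack => B le_B D le_D.
rewrite !expnS expn0; nia.
Qed.

(** * Correctness *)

Lemma knapsack_max_optimal (R : realFieldType) (n : nat)
    (w : 'I_n -> nat) (p : 'I_n -> R) (t : nat) (v : R) :
  optimal w p t v -> knapsack_max w p t v.
Proof.
have feasibleE m : feasible w t m = (lincomb w m <= t)%N.
  by congr (_ <= t)%N; apply: eq_bigr => i _; lia.
have profitE m : profit p m = lincomb p m.
  by apply: eq_bigr => i _; rewrite mulr_natl.
move=> [[m le_t <-] dom]; split=> [|m'].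
  by exists m; rewrite feasibleE profitE.
by rewrite feasibleE profitE; exact: dom.
Qed.

Section Correctness.

Variables (R : realFieldType) (b n : nat) (w : 'I_n -> nat) (p : 'I_n -> R).
Variable t : nat.
Hypotheses (n_gt0 : (0 < n)%N) (t_gt0 : (0 < t)%N).
Hypotheses (w_gt0 : forall i, (0 < w i)%N) (p_gt0 : forall i, 0 < p i).

Local Notation u := (max_weight w).

Hypothesis word_large :
  (n + 2 * slack u + slack u * u + 2 * u + 2 * t + 5 < 2 ^ b)%N.

Let b_gt1 : (1 < 2 ^ b)%N. Proof. lia. Qed.

Lemma max_weight_gt0 : (0 < u)%N.
Proof. exact: leq_trans (w_gt0 (Ordinal n_gt0)) (leq_bigmax _). Qed.

Lemma input_has_input : has_input w p (input w p t).
Proof. by split=> //= i; rewrite arrayE. Qed.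

Lemma runs_reduce_capacity :
  runs b reduce_capacity (input w p t) (19 * n + 4 * bits u + 28) (fun s =>
    [/\ wreg s rWindow = (2 * slack u + 2)%N, (0 < wreg s rCapacity <= t)%N,
        (wreg s rCapacity <= slack u * u + u)%N &
        forall v, optimal w p (wreg s rCapacity) v ->
          optimal w p t (v + rreg s xTaken)]).
Proof.
have u_gt0 := max_weight_gt0; have n_small : (n < 2 ^ b)%N by lia.
have bound_gt0 : (0 < slack u * u)%N by rewrite !muln_gt0 u_gt0.
have in0 := input_has_input.
apply: (runs_seq (runs_find_max_weight b_gt1 in0 n_small)); last by lia.
move=> s1 fr1 s1_max; have in1 := has_input_frame fr1 isT in0.
apply: (runs_seq (runs_find_best_item b_gt1 in1 n_gt0 n_small w_gt0));
  last by lia.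
move=> s2 fr2 [i0 s2_best best]; have in2 := has_input_frame fr2 isT in1.
have [[f1W _ _ _] [f2W _ _ _]] := (fr1, fr2).
have s2_max : wreg s2 rMaxWeight = u by rewrite f2W.
apply: (runs_seq (runs_set_bounds b_gt1 s2_max u_gt0 _)); [by lia| |by lia].
move=> s3 fr3 [s3_bound s3_window]; have in3 := has_input_frame fr3 isT in2.
have [f3W _ _ _] := fr3.
apply: runs_weaken.
- apply: (runs_take_best_copies (t := t) (u := u) b_gt1 in3 _ _ s3_bound).
  + by rewrite f3W // f2W // f1W.
  + by rewrite f3W // s2_best.
  + lia.
- lia.
- move=> s4 [f4W _ _ _] [s4_cap s4_taken].
  have spare_le := weight_spare_copies_le w i0 u t.
  split; rewrite ?s4_cap ?s4_taken; [by rewrite f4W|by lia| |].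
    exact: capacity_spare_copies_le (@leq_bigmax _ w) t.
  move=> v; apply: optimal_spare_copies => //; first exact: leq_bigmax.
  exact: ltW.
Qed.

Lemma runs_knapsack :
  runs b knapsack (input w p t)
    (19 * n + 4 * bits u + 4 * bits u * (level_time n (slack u) + 7) + 43)
    (fun s => optimal w p t (output s)).
Proof.
apply: (runs_seq runs_reduce_capacity); last by lia.
move=> s1 fr1 [s1_window /andP[cap_gt0 cap_le] cap_small lift].
have in1 := has_input_frame fr1 isT input_has_input.
have le_bits := bits_reduced_capacity_le cap_gt0 cap_small.
have le_time : (bits (wreg s1 rCapacity) * (level_time n (slack u) + 7) <=
    4 * bits u * (level_time n (slack u) + 7))%N.
  by rewrite leq_mul2r le_bits orbT.
have odd_weight_le := odd_weight_wlog_slack p w_gt0 (@leq_bigmax _ w).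
apply: (runs_seq (runs_solve_by_halving (D := slack u) b_gt1 w_gt0 odd_weight_le
  _ _ _ in1 erefl s1_window cap_gt0 _)); try lia.
move=> s2 [_ _ f2X _] optimal_s2; apply: runs_instr; last by lia.
case: s2 f2X optimal_s2 => W2 M2 X2 Y2 /= f2X optimal_s2.
by rewrite /output /= (f2X xTaken) //; exact: lift.
Qed.

End Correctness.

Theorem theorem4 :
  exists (A : cmd) (c C : nat),
  forall (R : realFieldType) (n : nat) (w : 'I_n -> nat) (p : 'I_n -> R)
         (t b : nat),
    (0 < n)%N -> (0 < t)%N ->
    (forall i, (0 < w i)%N) -> (forall i, 0 < p i) ->
    let u := max_weight w in
    (c * bits (n + u + t) <= b)%N ->
    exists (k : nat) (s : state R),
      [/\ exec b A (input w p t) k s,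
          (k <= C * (n * u * log u ^ 2))%N &
          knapsack_max w p t (output s)].
Proof.
exists knapsack, 6%N, 2760%N => R n w p t b n_gt0 t_gt0 w_gt0 p_gt0 u le_b.
have u_gt0 : (0 < u)%N := max_weight_gt0 n_gt0 w_gt0.
have word_large := word_size_suffices n_gt0 u_gt0 t_gt0 le_b.
have [k [s [run_A le_k opt]]] :=
  runs_knapsack n_gt0 t_gt0 w_gt0 p_gt0 word_large.
exists k, s; split=> //; last exact: knapsack_max_optimal.
exact: leq_trans le_k (running_time_le n_gt0 u_gt0).
Qed.
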